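(* Let $C_2(n)$ be the number of payphone permutations of type (C2) and size $n$. Then for any integer $n\geq 1$, $$C_2(n) = n\cdot F(S(n-1)),$$ where the function $F$ is defined on the finite multisets $M$ of positive integers by $$F(M) := \bigg(\prod_{k\geq 1} (\#_k M)!\bigg)\cdot 2^{\sum_{k\geq 1} \#_{2k} M}.$$
   Context: Multisets: $\#_k M$ denotes the multiplicity of $k$ in the multiset $M$, and $\cup$ denotes union of multisets with multiplicities added. For $n\ge 0$, the finite multiset $S(n)$ of positive integers is defined recursively by $S(0)=\emptyset$ and $$S(n)=\{n\}\cup S\left(\left\lfloor\tfrac{n-1}{2}\right\rfloor\right)\cup S\left(\left\lceil\tfrac{n-1}{2}\right\rceil\right)\quad (n\ge 1).$$ Type (C2) payphone permutations: $n$ payphones, labeled $1,\dots,n$, are arranged in a circle. Persons $1,2,\dots,n$ come one after another and each occupies an available payphone. The first person takes any payphone. Each subsequent person obeys the following rule. An interval is a maximal sequence of available consecutive payphones; on the circle every interval is closed, i.e., flanked by an occupied payphone on each side (when only one payphone is occupied, the remaining $n-1$ payphones form one closed interval of length $n-1$, flanked on both sides by that payphone). The length of an interval is the number of payphones in it. The person first selects any interval of greatest length and then takes, within it, any payphone whose distance (along the circle) to its closest occupied payphone is as large as possible. The resulting assignment of people to payphones, $(p_1,\dots,p_n)$ with $p_j$ the person occupying payphone $j$, is a payphone permutation of type (C2) and size $n$; $C_2(n)$ counts the distinct permutations of $\{1,\dots,n\}$ that can arise this way. *)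

(* Defs.v *)
From mathcomp Require Import all_boot all_fingroup.
From mathcomp Require Import finmap multiset.

Set Implicit Arguments.
Unset Strict Implicit.
Unset Printing Implicit Defensive.

Local Open Scope mset_scope.
Local Open Scope nat_scope.

(* The n payphones on the circle and the n persons are both indexed by 'I_n,
   so payphone or person number k (counted from 1) is the ordinal of value
   k - 1; payphone j is adjacent to j - 1 and j + 1 modulo n. *)

Section Circle.

Variable n : nat.
Implicit Types (i j k a o : 'I_n) (A B O : {set 'I_n}).

(* The l consecutive payphones a, a + 1, ..., a + l - 1 (modulo n). *)
Definition arc a (l : nat) : {set 'I_n} := [set j : 'I_n | (j + n - a) %% n < l].

Definition free_arc O A : bool :=
  [exists a : 'I_n, exists l : 'I_n.+1, (0 < l) && (A == arc a l)]
  && [disjoint A & O].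

(* O is the set of occupied payphones. As soon as O is non-empty, a maximal
   free arc A is flanked by occupied payphones and has length #|A|. *)
Definition interval O A : bool := maxset (free_arc O) A.

Definition longest_interval O A : bool :=
  interval O A && [forall B, interval O B ==> (#|B| <= #|A|)].

Definition circ_dist i j : nat := minn ((i + n - j) %% n) ((j + n - i) %% n).

(* Circular distances are less than n, so the default value n plays no role
   when O is non-empty. *)
Definition dist_closest O j : nat := \big[minn/n]_(o in O) circ_dist j o.

Definition C2_rule O j : bool :=
  [exists A, [&& longest_interval O A, j \in A &
    [forall k in A, dist_closest O k <= dist_closest O j]]].

(* p j is the person occupying payphone j. When person i arrives, the occupied
   payphones are the j with p j < i, and i takes payphone p^-1 i; the first
   person is unconstrained. *)
Definition C2_perm (p : 'S_n) : bool :=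
  [forall i : 'I_n, (0 < i) ==> C2_rule [set j | p j < i] ((p^-1)%g i)].

End Circle.

Definition C2 (n : nat) : nat := #|[set p : 'S_n | C2_perm p]|.

(* Structural recursion on a bound m >= n, since the recursive calls are not
   structural in n; Smset0 and SmsetE are the intended equations. *)
Fixpoint Smset_rec (m n : nat) : {mset nat} :=
  if m is m'.+1 then
    if n is 0 then mset0
    else ([mset n] `+` Smset_rec m' (n - 1)./2
                   `+` Smset_rec m' (uphalf (n - 1)))%mset
  else mset0.

Definition Smset (n : nat) : {mset nat} := Smset_rec n n.

Lemma Smset_rec_bound m n : n <= m -> Smset_rec m n = Smset n.
Proof.
rewrite /Smset; elim/ltn_ind: n m => -[|n] IHn [|m] //= le_nm.
have le_half : n./2 <= n by rewrite leq_half_double -addnn -addnS leq_addr.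
have le_uphalf : uphalf n <= n by rewrite leq_uphalf_double -addnn leq_addr.
have IH k l : k <= n -> n <= l -> Smset_rec l k = Smset_rec k k.
  by move=> le_kn le_nl; apply: IHn; [rewrite ltnS | apply: leq_trans le_nl].
by rewrite subn1 /= !(IH n./2) ?(IH (uphalf n)).
Qed.

Lemma Smset0 : Smset 0 = mset0.
Proof. by []. Qed.

Lemma SmsetE n : 1 <= n ->
  Smset n = ([mset n] `+` Smset (n - 1)./2 `+` Smset (uphalf (n - 1)))%mset.
Proof.
case: n => // n _; rewrite {1}/Smset /= subn1 /=.
rewrite !Smset_rec_bound // ?leq_uphalf_double ?leq_half_double -addnn.
- by rewrite leq_addr.
- by rewrite -addnS leq_addr.
Qed.

(* M k = 0 for every k > maxsupp M. *)
Definition maxsupp (M : {mset nat}) : nat := \max_(k <- finsupp M) k.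

(* Terms with k > maxsupp M contribute factors 0! = 1 and summands 0, so the
   truncated product and sum are those over all k >= 1. *)
Definition F (M : {mset nat}) : nat :=
  (\prod_(1 <= k < (maxsupp M).+1) (M k)`!)
  * 2 ^ (\sum_(1 <= k < (maxsupp M).+1) M (2 * k)).

(* Main.v *)
(* A permutation of type (C2) is the same thing as a play: the sequence of
   payphones chosen by persons 1, 2, ..., n.  Attach to each occupied payphone o
   the length of the (possibly empty) run of free payphones that follows it
   clockwise, and let T(O) be the union of the S(gap) over these runs.  A person
   breaks a gap g of greatest length into floor((g-1)/2) and ceil((g-1)/2), so
   each step removes exactly one copy of g from T(O); and since S(k) contains k
   once and otherwise only smaller numbers, the multiplicity of g in T(O) is the
   number of gaps of length g.  Hence the number of payphones that may be chosen
   is the factor by which F(T(O)) decreases, and by induction F(T(O)) counts the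
   ways of completing the play from O. *)

Require Import Defs.
From HB Require Import structures.
From mathcomp Require Import all_boot all_fingroup.
From mathcomp Require Import finmap multiset.
From mathcomp Require Import zify.

Set Implicit Arguments.
Unset Strict Implicit.
Unset Printing Implicit Defensive.

Local Open Scope mset_scope.
Local Open Scope nat_scope.

(** * Sums of multisets, and [F] under the addition of an element *)

Section MsetMonoid.

Variable K : choiceType.

HB.instance Definition _ := Monoid.isComLaw.Build {mset K} mset0 (@msetD K)
  (@msetDA K) (@msetDC K) (@mset0D K).

Lemma big_msetDE (I : finType) (P : pred I) (f : I -> {mset K}) k :
  (\big[@msetD K/mset0]_(i | P i) f i) k = \sum_(i | P i) f i k.
Proof.
by apply: (big_morph (fun M : {mset K} => M k)) => [A B|];
  rewrite ?msetE2 ?mset0E.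
Qed.

End MsetMonoid.

Lemma leq_maxsupp (M : {mset nat}) k : k \in M -> k <= maxsupp M.
Proof. by rewrite -msuppE => kM; exact: leq_bigmax_seq. Qed.

Lemma maxsupp_leq (M : {mset nat}) b :
  (forall k, k \in M -> k <= b) -> maxsupp M <= b.
Proof. by move=> leb; apply/bigmax_leqP_seq => k; rewrite msuppE => /leb. Qed.

(** Allows [F] of two multisets to be compared over one common range. *)
Lemma F_widen b (M : {mset nat}) : maxsupp M < b ->
  F M = (\prod_(1 <= k < b) (M k)`!) * 2 ^ (\sum_(1 <= k < b) M (2 * k)).
Proof.
move=> ltb.
have M0 k : maxsupp M < k -> M k = 0.
  by move=> ltk; apply/mset_eq0P; apply: contraL ltk; rewrite -leqNgt => /leq_maxsupp.
rewrite (@big_cat_nat _ _ _ (maxsupp M).+1 1 b) //=.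
rewrite [\sum_(1 <= k < b) _](@big_cat_nat _ _ _ (maxsupp M).+1 1 b) //=.
rewrite [X in _ * X * _]big_nat_cond [X in _ * X * _]big1 ?muln1; last first.
  by move=> k /andP[/andP[ltk _] _]; rewrite M0.
rewrite [X in 2 ^ (_ + X)]big_nat_cond [X in 2 ^ (_ + X)]big1 ?addn0 //.
by move=> k /andP[/andP[ltk _] _]; rewrite M0 //; lia.
Qed.

Lemma F_mset0 : F mset0 = 1.
Proof. by rewrite /F !big1 // => k _; rewrite mset0E. Qed.

(** The factorial at [L] gains the factor [(M L).+1]; the exponent of 2 grows by one exactly when
    [L] is some [2 * k], and then only at [k = L./2]. *)
Lemma F_mset1D L (M : {mset nat}) : 0 < L ->
  F (L +` M)%mset = (M L).+1 * 2 ^ (~~ odd L) * F M.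
Proof.
move=> L_gt0; set N := (L +` M)%mset.
pose b := (maxn L (maxsupp M)).+1.
have ltM : maxsupp M < b by rewrite ltnS leq_maxr.
have ltN : maxsupp N < b.
  rewrite ltnS; apply: maxsupp_leq => k; rewrite in_mset1D.
  by case/orP=> [/eqP-> | /leq_maxsupp]; lia.
rewrite (F_widen ltM) (F_widen ltN).
have Lb : 1 <= L < b by rewrite L_gt0 ltnS leq_maxl.
have Lr : L \in index_iota 1 b by rewrite mem_index_iota.
rewrite [\prod_(1 <= k < b) (N k)`!](bigD1_seq L) ?iota_uniq //=.
rewrite [\prod_(1 <= k < b) (M k)`!](bigD1_seq L) ?iota_uniq //=.
rewrite mset1DE eqxx add1n factS.
rewrite (eq_bigr (fun k => (M k)`!)) => [|k /negPf nk]; last first.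
  by rewrite mset1DE nk.
suff -> : \sum_(1 <= k < b) N (2 * k)
          = (~~ odd L) + \sum_(1 <= k < b) M (2 * k).
  rewrite expnD -!mulnA; congr (_ * _).
  by rewrite [RHS]mulnCA; congr (_ * _); apply: mulnCA.
under eq_bigr do rewrite mset1DE.
rewrite big_split /=; congr (_ + _).
case: (boolP (odd L)) => oddL /=.
  by rewrite big1 // => k _; case: eqP oddL => // <-; rewrite mul2n odd_double.
have hr : L./2 \in index_iota 1 b by rewrite mem_index_iota; lia.
rewrite (bigD1_seq L./2) ?iota_uniq //= big1; last first.
  by move=> k; case: eqP => //; lia.
by rewrite mul2n even_halfK ?eqxx.
Qed.

(** * Multiplicities in [Smset n] *)

Lemma Smset_leq n k : k \in Smset n -> k <= n.
Proof.
elim/ltn_ind: n k => -[|n] IHn k; first by rewrite Smset0 in_mset0.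
rewrite SmsetE // !in_msetD in_mset1 subn1 /= => /orP[/orP[/eqP-> //|]|] /IHn; lia.
Qed.

Lemma Smset_diag n : Smset n n = (0 < n).
Proof.
case: n => [|n]; first by rewrite Smset0 mset0E.
have S0 m : m <= n -> Smset m n.+1 = 0.
  by move=> lemn; apply/mset_eq0P/negP => /Smset_leq; lia.
by rewrite SmsetE // !msetE2 msetnxx subn1 /= !S0 //; lia.
Qed.

Lemma Smset_gt n k : n < k -> Smset n k = 0.
Proof. by move=> ltnk; apply/mset_eq0P/negP => /Smset_leq; lia. Qed.

Lemma card_ltn_ord n g : g <= n -> #|[set j : 'I_n | j < g]| = g.
Proof.
move=> legn; rewrite -sum1dep_card -(big_ord_widen_cond _ xpredT (fun=> 1)) //.
by rewrite sum1_card card_ord.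
Qed.

(** * Permutations as sequences of choices *)

Section PlayCount.

Variable (n : nat) (R : {set 'I_n} -> 'I_n -> bool).
Implicit Types (O : {set 'I_n}) (s : seq 'I_n) (p : 'S_n).

Fixpoint plays (m : nat) O : nat :=
  if m is m'.+1 then \sum_(j | (j \notin O) && R O j) plays m' (j |: O) else 1.

(* Persons 0, 1, ..., size s - 1 occupy the successive payphones of s. *)
Definition extends s p : bool := all (fun j => p j == index j s :> nat) s.

Lemma extends_rcons s j p : j \notin s ->
  extends (rcons s j) p = extends s p && (p j == size s :> nat).
Proof.
move=> njs; rewrite /extends all_rcons -cats1 index_cat (negPf njs) /= eqxx addn0.
rewrite andbC; congr (_ && _); apply: eq_in_all => x xs.
by rewrite index_cat xs.
Qed.

(** One inclusion is direct; equality follows by cardinality, because [p] is injective. *)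
Lemma extends_before s p : uniq s -> extends s p ->
  [set j | p j < size s] = [set j in s].
Proof.
move=> Us /allP es; apply/esym/eqP; rewrite eqEcard; apply/andP; split.
  apply/subsetP => j; rewrite !inE => js.
  by rewrite (eqP (es j js)) index_mem.
have -> : [set j | p j < size s] = p @^-1: [set j : 'I_n | j < size s].
  by apply/setP => j; rewrite !inE.
rewrite card_preimset; last exact: perm_inj.
have s_card : #|s| = size s by apply/card_uniqP.
rewrite card_ltn_ord -?s_card; first by rewrite cardsE.
by rewrite -[X in _ <= X]card_ord; apply: max_card.
Qed.

Lemma card_extends_full s : uniq s -> size s = n ->
  #|[set p | extends s p]| = 1.
Proof.
move=> Us sn.
have sT (j : 'I_n) : j \in s.
  have /subset_cardP s_full : #|s| = #|'I_n| by rewrite card_ord (card_uniqP Us).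
  by rewrite (s_full _) //; apply/subsetP.
have lt_index (j : 'I_n) : index j s < n by move: (sT j); rewrite -index_mem sn.
pose f j := Ordinal (lt_index j).
have f_inj : injective f.
  by move=> x y [] eqxy; rewrite -(nth_index x (sT x)) eqxy nth_index.
apply/eqP/cards1P; exists (perm f_inj); apply/setP => p; rewrite !inE.
apply/allP/eqP => [es | -> j _]; last by rewrite permE.
by apply/permP => j; apply/val_inj; rewrite permE; apply/eqP/es.
Qed.

(** Fixing the seats of the first [size s] persons makes an induction on the number [m] of remaining
    persons possible. *)
Lemma card_extends s m : uniq s -> size s + m = n ->
  #|[set p | extends s p && [forall i : 'I_n, (size s <= i) ==>
      R [set j | p j < i] (p^-1%g i)]]| = plays m [set j in s].
Proof.
elim: m s => [|m IHm] s Us sn /=.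
  rewrite addn0 in sn; rewrite -(card_extends_full Us sn); apply: eq_card => p.
  rewrite !inE; case: extends => //=; apply/forallP => i.
  by rewrite sn leqNgt ltn_ord.
have lt_s_n : size s < n by lia.
pose k := Ordinal lt_s_n.
rewrite -sum1dep_card.
(* The permutations are sorted by the payphone [j] of the next person [k]; those in one class extend
   [rcons s j]. *)
rewrite (partition_big (fun p : 'S_n => p^-1%g k)
  (fun j => (j \notin [set x in s]) && R [set x in s] j)) /=; last first.
  move=> p /andP[es /forallP/(_ k)]; rewrite leqnn /= (extends_before Us es).
  move=> ->; rewrite andbT inE; apply/negP => ks.
  have /eqP := allP es _ ks; rewrite permKV /= => eqk.
  by move: ks; rewrite -index_mem -eqk ltnn.
apply: eq_bigr => j /andP[]; rewrite inE => njs Rj.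
have -> : j |: [set x in s] = [set x in rcons s j].
  by apply/setP => x; rewrite !inE mem_rcons.
rewrite -IHm ?rcons_uniq ?njs ?size_rcons ?addSnnS // sum1dep_card.
apply: eq_card => p; rewrite !inE extends_rcons // -andbA.
have [es /= | //] := boolP (extends s p).
have -> : (p^-1%g k == j) = (p j == size s :> nat).
  by apply/eqP/eqP => [<- | pj]; [rewrite permKV
    | apply: (@perm_inj _ p); rewrite permKV; apply/val_inj].
rewrite andbC; case: eqP => //= pj.
have pk : p^-1%g k = j.
  by apply: (@perm_inj _ p); rewrite permKV; apply/val_inj.
apply/forallP/forallP => ok i; apply/implyP => lei.
  by move/implyP: (ok i); apply; apply: ltnW.
(* Compared with the conditions for [rcons s j], only the one at [i = k] is new, and it is [Rj]. *)
case: (ltngtP (size s) i) lei => // [lti | eqi] _.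
  by move/implyP: (ok i); apply.
have -> : i = k by apply/val_inj.
by rewrite /= (extends_before Us es) pk.
Qed.

Lemma card_plays :
  #|[set p : 'S_n | [forall i : 'I_n, R [set j | p j < i] (p^-1%g i)]]|
  = plays n set0.
Proof.
have -> : set0 = [set j : 'I_n in [::]] by apply/setP => j; rewrite !inE.
by rewrite -card_extends //; apply: eq_card => p; rewrite !inE.
Qed.

End PlayCount.

(** * Minima and clockwise gaps *)

Lemma leq_bigminn (I : finType) (P : pred I) (f : I -> nat) m k :
  (k <= \big[minn/m]_(i | P i) f i) = (k <= m) && [forall (i | P i), k <= f i].
Proof.
apply/idP/idP => [lek | /andP[lekm /forallP lekf]].
  have {}lek : (k <= m) && all (fun i => P i ==> (k <= f i)) (index_enum I).
    elim: (index_enum I) lek => [|i r IHr]; first by rewrite big_nil andbT.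
    rewrite big_cons /=; case: (P i) => //=; rewrite leq_min => /andP[-> /IHr].
    by [].
  case/andP: lek => -> /allP lek /=; apply/forallP => i.
  by apply: lek; rewrite mem_index_enum.
by apply: (big_ind (leq k)) => // [x y|i Pi]; [rewrite leq_min => -> ->
  | exact: (implyP (lekf i) Pi)].
Qed.

Section Gaps.

Variable n : nat.
Implicit Types (O A : {set 'I_n}) (o j x y a : 'I_n).

(** Splitting on wrap-around removes the modulus and leaves linear arithmetic; [aftP] does the same
    for [aft]. *)
Lemma fwdP a j :
  a <= j /\ (j + n - a) %% n + a = j \/ j < a /\ (j + n - a) %% n + a = j + n.
Proof.
have an := ltn_ord a; have jn := ltn_ord j; case: (leqP a j) => leaj.
  by left; split; rewrite // -addnBAC // modnDr modn_small; lia.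
by right; split; rewrite // modn_small; lia.
Qed.

(* The number of payphones strictly between o and j, going clockwise from o; it
   is n - 1 when j = o, so that a single occupied payphone needs no special
   case. *)
Definition aft o j : nat := (j + n - o.+1) %% n.

Lemma aftP o j :
  o < j /\ aft o j + o.+1 = j \/ j <= o /\ aft o j + o.+1 = j + n.
Proof.
have on := ltn_ord o; have jn := ltn_ord j; rewrite /aft.
case: (ltnP o j) => leoj.
  by left; split; rewrite // -addnBAC // modnDr modn_small; lia.
by right; split; rewrite // modn_small; lia.
Qed.

(** Each circular distance becomes a fresh number constrained only by [aftP] or [fwdP], after which
    [lia] applies. *)
Ltac circle_lia :=
  repeat match goal with
  | H : context [aft _ _] |- _ => move: H
  | H : context [_ %% _] |- _ => move: H
  end;
  repeat match goal with
  | |- context [aft ?o ?j] =>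
      generalize (aftP o j) (ltn_ord o) (ltn_ord j); generalize (aft o j)
  | |- context [modn (nat_of_ord ?j + ?m - nat_of_ord ?a) ?m] =>
      generalize (fwdP a j) (ltn_ord a) (ltn_ord j);
      generalize (modn (nat_of_ord j + m - nat_of_ord a) m)
  end; intros; lia.

Lemma aft_inj o : injective (aft o).
Proof.
by move=> j k eq_jk; apply/val_inj => /=; circle_lia.
Qed.

Lemma aft_lt o j : aft o j < n.
Proof. by circle_lia. Qed.

(** [aft o] is a bijection from the circle onto the numbers below [n]. *)
Lemma card_aft o (P : pred nat) :
  #|[set j | P (aft o j)]| = #|[set d : 'I_n | P d]|.
Proof.
pose f j := Ordinal (aft_lt o j).
have f_inj : injective f by move=> j k [] /aft_inj.
by rewrite -[RHS](card_preimset _ f_inj); apply: eq_card => j; rewrite !inE.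
Qed.

Lemma aft_surj o d : d < n -> exists j, aft o j = d.
Proof.
move=> ltdn; have : 0 < #|[set j | aft o j == d]|.
  rewrite (card_aft o (fun e => e == d)) card_gt0; apply/set0Pn.
  by exists (Ordinal ltdn); rewrite inE.
by rewrite card_gt0 => /set0Pn[j]; rewrite inE => /eqP oj; exists j.
Qed.

(** For non-empty [O], the length of the free run that follows [o] clockwise, up to the next
    occupied payphone, which may be [o] itself. *)
Definition gap O o : nat := \big[minn/n]_(x in O) aft o x.

Lemma gap_le O o x : x \in O -> gap O o <= aft o x.
Proof.
move=> xO; have := leqnn (gap O o); rewrite {2}/gap leq_bigminn.
by case/andP=> _ /forallP/(_ x)/implyP; apply.
Qed.

Lemma gap_attained O o : O != set0 -> exists2 x, x \in O & gap O o = aft o x.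
Proof.
case/set0Pn=> x0 x0O; pose x := [arg min_(x < x0 in O) aft o x].
have [xO x_min] : x \in O /\ forall y, y \in O -> aft o x <= aft o y.
  by rewrite /x; case: arg_minnP.
exists x => //; apply/eqP; rewrite eqn_leq gap_le //= leq_bigminn ltnW ?aft_lt //.
by apply/forall_inP.
Qed.

Lemma gap_lt O o : O != set0 -> gap O o < n.
Proof. by move=> /(gap_attained o)[x _ ->]; apply: aft_lt. Qed.

Lemma gap_eq O o x : x \in O -> (forall y, y \in O -> aft o x <= aft o y) ->
  gap O o = aft o x.
Proof.
move=> xO x_min; have /(gap_attained o)[y yO gy] : O != set0.
  by apply/set0Pn; exists x.
by apply/eqP; rewrite eqn_leq gap_le // gy x_min.
Qed.

(** The witness is the last occupied payphone before [j]: an occupied one between them would be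
    nearer to [j]. *)
Lemma gap_exists O j : O != set0 -> j \notin O ->
  exists2 o, o \in O & aft o j < gap O o.
Proof.
case/set0Pn=> o0 o0O jO; pose o := [arg min_(o < o0 in O) aft o j].
have [oO o_min] : o \in O /\ forall y, y \in O -> aft o j <= aft y j.
  by rewrite /o; case: arg_minnP.
exists o => //; have /(gap_attained o)[x xO ->] : O != set0.
  by apply/set0Pn; exists o.
have neq_jx : j <> x :> nat by move/val_inj=> jx; rewrite jx xO in jO.
by have := o_min x xO; circle_lia.
Qed.

(** If [o] and [x] differed, [j] would lie both on the arc from [o] to [x] and on the arc from [x]
    to [o], which are disjoint. *)
Lemma gap_unique O o x j : o \in O -> x \in O ->
  aft o j < gap O o -> aft x j < gap O x -> o = x.
Proof.
move=> oO xO /leq_trans/(_ (gap_le o xO)) lto /leq_trans/(_ (gap_le x oO)).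
by move=> ltx; apply/val_inj => /=; circle_lia.
Qed.

Lemma gap_free O o j : aft o j < gap O o -> j \notin O.
Proof. by apply: contraL => /(gap_le o); rewrite leqNgt. Qed.

Lemma gapU1_in O o j : aft o j < gap O o -> gap (j |: O) o = aft o j.
Proof.
move=> ltj; apply: gap_eq; first exact: setU11.
move=> y /setU1P[-> // | /(gap_le o)]; lia.
Qed.

Lemma gapU1_out O o j : O != set0 -> gap O o <= aft o j -> gap (j |: O) o = gap O o.
Proof.
move=> /(gap_attained o)[x xO gx] lej; rewrite gx; apply: gap_eq.
  by rewrite setU1r.
by move=> y /setU1P[-> | /(gap_le o)]; lia.
Qed.

(** The run after [j] ends where the old run after [o] ended; it loses [j] and the [aft o j]
    payphones before it. *)
Lemma gapU1_new O o j : o \in O -> aft o j < gap O o ->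
  gap (j |: O) j = gap O o - (aft o j).+1.
Proof.
move=> oO ltj; have [|x xO gx] := @gap_attained O o.
  by apply/set0Pn; exists o.
have -> : gap O o - (aft o j).+1 = aft j x.
  by move: ltj; rewrite gx; circle_lia.
apply: gap_eq; first by rewrite setU1r.
move=> y /setU1P[-> | yO]; first by circle_lia.
by have := gap_le o yO; move: ltj; rewrite gx; circle_lia.
Qed.

(** * Intervals, distances and the rule in terms of gaps *)

Definition gap_set O o : {set 'I_n} := [set j | aft o j < gap O o].

Lemma card_gap_set O o : O != set0 -> #|gap_set O o| = gap O o.
Proof.
move=> O0; rewrite (card_aft o (fun d => d < gap O o)).
by rewrite card_ltn_ord // ltnW ?gap_lt.
Qed.

Lemma free_arc_gap_set O o : O != set0 -> 0 < gap O o ->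
  free_arc O (gap_set O o).
Proof.
move=> O0 g0; have ltg := gap_lt o O0; have on := ltn_ord o.
apply/andP; split; last first.
  by apply/pred0P => j /=; rewrite inE; apply/andP => -[/gap_free/negPf->].
have [a oa] : exists a, aft o a = 0 by apply: aft_surj; lia.
apply/existsP; exists a; apply/existsP.
have ltg1 : gap O o < n.+1 by rewrite ltnS ltnW.
exists (Ordinal ltg1); rewrite g0 /=; apply/eqP/setP => j; rewrite !inE.
by congr (_ < _); circle_lia.
Qed.

(** The arc starts in the run of some [o] and cannot leave it without covering the occupied payphone
    that ends the run. *)
Lemma free_arc_sub O A : O != set0 -> free_arc O A ->
  exists o, [/\ o \in O, 0 < gap O o & A \subset gap_set O o].
Proof.
move=> O0 /andP[/existsP[a /existsP[l /andP[l0 /eqP->]]] /pred0P dis].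
have a_in : a \in Defs.arc a l by rewrite inE; circle_lia.
have aO : a \notin O by have := dis a; rewrite /= a_in /= => ->.
have [o oO lta] := gap_exists O0 aO.
exists o; split=> //; first by apply: leq_ltn_trans lta.
apply/subsetP => j; rewrite !inE => ltj; rewrite ltnNge; apply/negP => lej.
have [x xO gx] := gap_attained o O0.
have := dis x; rewrite /= xO andbT inE => /negbT; rewrite -leqNgt.
by move: lta lej ltj; rewrite gx; circle_lia.
Qed.

(** Every free arc lies in a single run, and runs of different occupied payphones are disjoint, so
    the maximal free arcs are the non-empty runs. *)
Lemma intervalP O A : O != set0 ->
  reflect (exists o, [/\ o \in O, 0 < gap O o & A = gap_set O o]) (interval O A).
Proof.
move=> O0; apply: (iffP maxsetP) => [[freeA maxA] | [o [oO g0 ->]]].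
  have [o [oO g0 sub]] := free_arc_sub O0 freeA.
  by exists o; split=> //; rewrite (maxA _ _ sub) // free_arc_gap_set.
split=> [|B freeB subB]; first exact: free_arc_gap_set.
have [x [xO _ sub]] := free_arc_sub O0 freeB.
suff ox : o = x by apply/eqP; rewrite eqEsubset subB andbT {1}ox.
have [j oj] : exists j, aft o j = 0 by apply: aft_surj; have := ltn_ord o; lia.
have jo : j \in gap_set O o by rewrite inE oj.
have := subsetP sub _ (subsetP subB _ jo); rewrite !inE in jo *.
exact: gap_unique jo.
Qed.

(** The closest occupied payphone is one of the two ends of the run containing [j]; any other is at
    least as far in both directions. *)
Lemma dist_closestE O o j : o \in O -> aft o j < gap O o ->
  dist_closest O j = minn (aft o j).+1 (gap O o - aft o j).
Proof.
move=> oO ltj; have O0 : O != set0 by apply/set0Pn; exists o.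
have [x xO gx] := gap_attained o O0.
apply/eqP; rewrite eqn_leq; apply/andP; split.
  have := leqnn (dist_closest O j); rewrite {2}/dist_closest leq_bigminn.
  case/andP=> _ /forall_inP le_dist.
  have := le_dist o oO; have := le_dist x xO; move: ltj.
  by rewrite gx /circ_dist; circle_lia.
rewrite leq_bigminn; apply/andP; split; first by have := aft_lt o j; lia.
apply/forall_inP => y yO; have := gap_le o yO; move: ltj.
by rewrite gx /circ_dist; circle_lia.
Qed.

(** For [g > 0], the positions [d < g] that maximise [minn d.+1 (g - d)]: one if [g] is odd, two if
    it is even. *)
Definition middle (g d : nat) : bool := (d == g.-1./2) || (d == g./2).

Lemma C2_ruleP O j : O != set0 ->
  reflect (exists o, [/\ o \in O, aft o j < gap O o,
             forall x, x \in O -> gap O x <= gap O o & middle (gap O o) (aft o j)])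
          (C2_rule O j).
Proof.
move=> O0; apply: (iffP existsP) => [[A] | [o [oO ltj maxo mid]]].
  case/and3P=> /andP[/(intervalP _ O0)[o [oO g0 ->]] /forallP maxo] jA /forall_inP far.
  have ltj : aft o j < gap O o by rewrite inE in jA.
  exists o; split=> // [x xO|].
    (* Empty runs are not intervals, so [maxo] says nothing about them. *)
    have [-> // | gx0] := posnP (gap O x).
    rewrite -(card_gap_set x O0) -(card_gap_set o O0).
    by apply: (implyP (maxo _)); apply/intervalP => //; exists x.
  (* This [k] attains the greatest distance in the run, so comparison with it forces [j] into the
     middle. *)
  have [k ok] : exists k, aft o k = (gap O o).-1./2.
    by apply: aft_surj; have := gap_lt o O0; lia.
  have ltk : aft o k < gap O o by lia.
  have kA : k \in gap_set O o by rewrite inE.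
  have := far k kA; rewrite !(dist_closestE oO) // ok /middle; lia.
have g0 : 0 < gap O o by apply: leq_ltn_trans ltj.
exists (gap_set O o); rewrite inE ltj /=; apply/andP; split.
  apply/andP; split; first by apply/intervalP => //; exists o.
  apply/forallP => B; apply/implyP => /(intervalP _ O0)[x [xO _ ->]].
  by rewrite !card_gap_set // maxo.
apply/forall_inP => k; rewrite inE => ltk; rewrite !(dist_closestE oO) //.
by move: mid; rewrite /middle; lia.
Qed.

End Gaps.

(** * Counting plays through the multiset of gaps *)

Section Count.

Variable n : nat.
Implicit Types (O : {set 'I_n}) (o j x : 'I_n).

(** The multiset T(O); empty runs contribute [Smset 0], which is empty. *)
Definition gap_Smset O : {mset nat} :=
  \big[@msetD nat/mset0]_(o in O) Smset (gap O o).

(** The parts [d] and [g - d.+1] are the two halves of [g - 1], in an order that depends on which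
    middle position [d] is. *)
Lemma Smset_split g d : d < g -> middle g d ->
  Smset g = (g +` (Smset (g - d.+1) `+` Smset d))%mset.
Proof.
move=> ltdg mid; rewrite SmsetE; last by lia.
rewrite -msetDA; congr (_ `+` _)%mset; case/orP: mid => /eqP d_eq.
  by rewrite msetDC; congr (Smset _ `+` Smset _)%mset; lia.
by congr (Smset _ `+` Smset _)%mset; lia.
Qed.

Lemma gap_SmsetU1 O o j : o \in O -> aft o j < gap O o ->
  middle (gap O o) (aft o j) ->
  gap_Smset O = (gap O o +` gap_Smset (j |: O))%mset.
Proof.
move=> oO ltj mid; have O0 : O != set0 by apply/set0Pn; exists o.
rewrite /gap_Smset big_setU1 ?(gap_free ltj) //= !(bigD1 o oO) /=.
rewrite (gapU1_new oO ltj) (gapU1_in ltj) (Smset_split ltj mid) -!msetDA.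
congr (_ `+` (_ `+` (_ `+` _)))%mset.
(* No other run contains [j], so the remaining gaps are unchanged. *)
apply: eq_bigr => x /andP[xO neq_xo]; rewrite gapU1_out // leqNgt.
by apply: contra neq_xo => ltx; rewrite (gap_unique xO oO ltx ltj).
Qed.

Lemma gap_Smset_max O g : 0 < g -> (forall o, o \in O -> gap O o <= g) ->
  gap_Smset O g = #|[set o in O | gap O o == g]|.
Proof.
move=> g0 maxg; rewrite /gap_Smset big_msetDE -sum1dep_card big_mkcondr /=.
apply: eq_bigr => o oO; have [-> | neq] := eqVneq (gap O o) g.
  by rewrite Smset_diag g0.
by rewrite Smset_gt // ltn_neqAle neq maxg.
Qed.

Lemma card_middle g : 0 < g < n -> #|[set d : 'I_n | middle g d]| = 2 ^ (~~ odd g).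
Proof.
move=> /andP[g0 ltgn].
have lt1 : g.-1./2 < n by lia.
have lt2 : g./2 < n by lia.
have -> : [set d : 'I_n | middle g d] = [set Ordinal lt1; Ordinal lt2].
  by apply/setP => d; rewrite !inE /middle -!val_eqE.
rewrite cards2 -val_eqE /=; case: (boolP (odd g)) => oddg /=.
  by have -> : g.-1./2 = g./2; [lia | rewrite eqxx].
by have -> : (g.-1./2 == g./2) = false by lia.
Qed.

(** Double counting of pairs of an allowed payphone and the longest run containing it: each allowed
    payphone is in exactly one such run, and each run has [2 ^ (~~ odd g)] middle positions. *)
Lemma card_C2_rule O g : O != set0 -> 0 < g < n ->
  (forall o, o \in O -> gap O o <= g) -> (exists2 o, o \in O & gap O o = g) ->
  #|[set j | C2_rule O j]| = #|[set o in O | gap O o == g]| * 2 ^ (~~ odd g).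
Proof.
move=> O0 g_bound maxg [o0 o0O go0].
have g0 : 0 < g by case/andP: g_bound.
pose M o := (o \in O) && (gap O o == g).
have ruleP j : reflect (exists2 o, M o & middle g (aft o j)) (C2_rule O j).
  apply: (iffP (C2_ruleP j O0)) => [[o [oO ltj maxo mid]] | [o /andP[oO /eqP go] mid]].
    have go : gap O o = g by apply/eqP; rewrite eqn_leq maxg //= -go0 maxo.
    by exists o; rewrite -?go // /M oO go eqxx.
  exists o; split=> //; rewrite go //.
  by move: mid; rewrite /middle; lia.
rewrite -sum1dep_card (eq_bigr (fun j => \sum_(o | M o && middle g (aft o j)) 1)).
  rewrite (exchange_big_dep M) /=; last by move=> j o _ /andP[].
  rewrite -sum1dep_card big_distrl; apply: eq_bigr => o Mo.
  rewrite /= mul1n -(card_middle g_bound) -(card_aft o (middle g)) -sum1dep_card.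
  apply: eq_bigl => j; rewrite Mo /=; case mid: (middle g (aft o j)); last exact: andbF.
  by rewrite andbT; apply/ruleP; exists o.
move=> j /ruleP[o Mo mid]; rewrite (big_pred1 o) // => x /=.
apply/andP/eqP => [[Mx midx] | ->] //.
case/andP: Mo => oO /eqP go; case/andP: Mx => xO /eqP gx.
apply: (gap_unique xO oO (j := j)).
  by move: midx; rewrite gx /middle; lia.
by move: mid; rewrite go /middle; lia.
Qed.

(* Any payphone is allowed to the first person, as in C2_perm. *)
Definition seat_rule O j : bool := (O == set0) || C2_rule O j.

Lemma plays_gap_Smset m O : O != set0 -> #|O| + m = n ->
  plays seat_rule m O = F (gap_Smset O).
Proof.
elim: m O => [|m IHm] O O0 cardO /=.
  have OT : O = setT.
    by apply/eqP; rewrite eqEcard subsetT cardsT card_ord; lia.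
  rewrite /gap_Smset big1 ?F_mset0 // => o _; suff -> : gap O o = 0 by [].
  rewrite -card_gap_set //; apply: eq_card0 => j; rewrite inE.
  by apply/negP => /gap_free; rewrite OT inE.
have [j0 j0O] : exists j, j \notin O.
  apply/existsP; rewrite -negb_forall; apply/negP => /forallP allO.
  suff : #|O| = n by lia.
  by rewrite -[RHS]card_ord; apply: eq_card => j; rewrite allO.
have [o0 o0O lt0] := gap_exists O0 j0O.
pose o := [arg max_(x > o0 in O) gap O x].
have [oO maxo] : o \in O /\ forall x, x \in O -> gap O x <= gap O o.
  by rewrite /o; case: arg_maxnP.
set g := gap O o in maxo.
have g0 : 0 < g by apply: leq_trans (maxo _ o0O); lia.
have g_bound : 0 < g < n by rewrite g0 gap_lt.
pose N := (gap_Smset O `\ g)%mset.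
have NK : (g +` N)%mset = gap_Smset O.
  apply: msetB1K; rewrite in_mset gap_Smset_max // card_gt0.
  by apply/set0Pn; exists o; rewrite inE oO eqxx.
(* Every allowed choice removes one copy of [g], so all summands agree. *)
rewrite (eq_bigr (fun=> F N)) => [|j /andP[jO rule_j]]; last first.
  move: rule_j; rewrite /seat_rule (negPf O0) /= => /(C2_ruleP _ O0)[x [xO ltj maxx mid]].
  rewrite IHm; last by rewrite cardsU1 jO; lia.
    have gx : gap O x = g by apply/eqP; rewrite eqn_leq maxo // maxx.
    by rewrite /N (gap_SmsetU1 xO ltj mid) gx msetD1K.
  by apply/set0Pn; exists j; rewrite setU11.
rewrite -NK F_mset1D // sum_nat_const; congr (_ * _).
(* Restoring the removed copy of [g] gives the number of longest runs. *)
have -> : (N g).+1 = gap_Smset O g by rewrite -NK mset1DE eqxx.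
rewrite gap_Smset_max // -card_C2_rule //; last by exists o.
apply: eq_card => j; rewrite [RHS]inE unfold_in /seat_rule (negPf O0) /=.
apply: andb_idl => /(C2_ruleP _ O0)[x [_ ltj _ _]]; exact: gap_free ltj.
Qed.

Lemma C2_plays : C2 n = plays seat_rule n set0.
Proof.
rewrite -card_plays; apply: eq_card => p; rewrite !inE; apply: eq_forallb => i.
rewrite /seat_rule; case: posnP => [i0 | i_gt0] /=.
  by apply/esym/orP; left; apply/eqP/setP => j; rewrite !inE i0.
have n0 : 0 < n by apply: leq_ltn_trans (ltn_ord i).
(* For [i > 0] the payphone of person 0 is already occupied, so the empty-circle clause of
   [seat_rule] fails. *)
case: eqP => // /setP/(_ (p^-1%g (Ordinal n0))).
by rewrite !inE permKV i_gt0.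
Qed.

End Count.

Theorem theorem2 (n : nat) (hn : (1 <= n)%N) :
  C2 n = (n * F (Smset (n - 1)))%N.
Proof.
rewrite C2_plays; case: n hn => // n _ /=.
rewrite (eq_bigr (fun=> F (Smset (n.+1 - 1)))) => [|j _]; last first.
  (* The circle now has [n.+1] payphones, so the first person leaves a single run of length [n],
     whatever [j] is. *)
  have jj : aft j j = n by have := aftP j j; lia.
  rewrite setU0 plays_gap_Smset ?cards1 ?add1n //; last by apply/set0Pn; exists j; rewrite inE.
  rewrite /gap_Smset big_set1 (@gap_eq _ _ _ j) ?inE // ?jj ?subn1 //.
  by move=> y; rewrite inE => /eqP->; rewrite jj.
rewrite sum_nat_const; congr (_ * _).
by rewrite -[RHS]card_ord; apply: eq_card => j; rewrite unfold_in inE /seat_rule eqxx.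
Qed.
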